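(* Let $H_1,\dots,H_L\in\mathbb{R}^{m\times\nu}$, let $w_\ell(\omega_k)=H_\ell^T\omega_k$, and let $\widetilde{\mathfrak R}_\ell[\cdot]$, the geometric medians $z_\ell(\omega^K)$ and the aggregated estimate $\widehat w^{(r)}(\omega^K)$ be as defined in the context. Then for every $\ell\le L$ and every $k\le K$ $$ \sup_{x\in\mathcal X}\mathbf E_{\eta_k,\xi_k}\big\{\|R_\ell^{1/2}(w_\ell(\omega_k)-Bx)\|_2^2\big\}\le\widetilde{\mathfrak R}_\ell^2[H_\ell], $$ and for every $\ell\le L$ and every $x\in\mathcal X$ $$ \mathrm{Prob}\big\{\|R_\ell^{1/2}(z_\ell(\omega^K)-Bx)\|_2\ge4\widetilde{\mathfrak R}_\ell[H_\ell]\big\}\le e^{-0.1070K}. $$ As a consequence, whenever $K\ge\ln[L/\epsilon]/0.1070$, the $\epsilon$-risk of the aggregated estimate satisfies $$ \mathrm{Risk}_\epsilon[\widehat w^{(r)}(\omega^K)|\mathcal X]\le\overline{\mathfrak R},\qquad\overline{\mathfrak R}=8\max_{\ell\le L}\widetilde{\mathfrak R}_\ell[H_\ell]. $$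
   Context: Notation: $\mathbf S^d_+$ is the cone of positive semidefinite symmetric $d\times d$ matrices, $\succeq$ the semidefinite order; $[M_1;\dots;M_q]$ is vertical and $[M_1,\dots,M_q]$ horizontal concatenation; $\|\cdot\|_{\mathrm{Fro}}$ is the Frobenius norm; $\phi_{\mathcal T}(y)=\sup_{u\in\mathcal T}y^Tu$. Signal set: $\mathcal X=\{x\in\mathbb{R}^n:\exists t\in\mathcal T:\ x^TT_jx\le t_j,\ j\le J\}$ (a basic ellitope), where $T_j\in\mathbf S^n_+$, $\sum_jT_j\succ0$, and $\mathcal T\subset\mathbb{R}^J_+$ is a convex compact set with nonempty interior such that $0\le t'\le t\in\mathcal T$ implies $t'\in\mathcal T$. The error is measured in the norm $\|u\|=\max_{\ell\le L}\sqrt{u^TR_\ell u}$ on $\mathbb{R}^\nu$, $R_\ell\in\mathbf S^\nu_+$, $\sum_\ell R_\ell\succ0$. Given are $B\in\mathbb{R}^{\nu\times n}$, $A,A_1,\dots,A_q\in\mathbb{R}^{m\times n}$, $\sigma>0$ and $\epsilon\in(0,1)$; $A[\eta]=A+\sum_{\alpha=1}^q\eta_\alpha A_\alpha$. Observation: $\omega^K=\{\omega_k=A[\eta_k]x+\xi_k,\ k=1,\dots,K\}$ with $x\in\mathcal X$ unknown and with pairs $(\xi_k,\eta_k)\in\mathbb{R}^m\times\mathbb{R}^q$ of random vectors independent across $k$, each satisfying $\mathbf E\{\xi_k\xi_k^T\}\preceq\sigma^2I_m$ and $\mathbf E\{\eta_k\eta_k^T\}\preceq I_q$. (Sub-Gaussianity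 is not assumed.) For $\ell\le L$ and $H\in\mathbb{R}^{m\times\nu}$ put $$\widetilde{\mathfrak R}_\ell[H]=\min_{\lambda,\mu,\kappa,\varkappa}\big\{\sigma\|HR_\ell^{1/2}\|_{\mathrm{Fro}}+\lambda+\phi_{\mathcal T}(\mu)+\kappa+\phi_{\mathcal T}(\varkappa)\big\}$$ over real $\lambda,\kappa$ and $\mu,\varkappa\in\mathbb{R}^J$ subject to $\mu\ge0$, $\varkappa\ge0$, $$\begin{bmatrix}\kappa I_\nu&\tfrac12R_\ell^{1/2}[B-H^TA]\\ \tfrac12[B-H^TA]^TR_\ell^{1/2}&\sum_j\varkappa_jT_j\end{bmatrix}\succeq0,\quad \begin{bmatrix}\lambda I_{\nu q}&\tfrac12[R_\ell^{1/2}H^TA_1;\dots;R_\ell^{1/2}H^TA_q]\\ \tfrac12[A_1^THR_\ell^{1/2},\dots,A_q^THR_\ell^{1/2}]&\sum_j\mu_jT_j\end{bmatrix}\succeq0.$$ Aggregated estimate: $z_\ell(\omega^K)\in\mathrm{Argmin}_{z\in\mathbb{R}^\nu}\sum_{k=1}^K\|R_\ell^{1/2}(w_\ell(\omega_k)-z)\|_2$, $\ell\le L$; set $$\mathcal W(\omega^K)=\bigcap_{\ell=1}^L\{w\in\mathbb{R}^\nu:\|R_\ell^{1/2}(z_\ell(\omega^K)-w)\|_2\le4\widetilde{\mathfrak R}_\ell[H_\ell]\};$$ $\widehat w^{(r)}(\omega^K)$ is any point of $\mathcal W(\omega^K)$ if this set is nonempty, and a once for ever fixed point (e.g. $0$)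 otherwise. The $\epsilon$-risk of an estimate $\widehat w(\omega^K)$ of $Bx$ is $\mathrm{Risk}_\epsilon[\widehat w|\mathcal X]=\sup_{x\in\mathcal X}\inf\{\rho:\mathrm{Prob}\{\|Bx-\widehat w(\omega^K)\|>\rho\}\le\epsilon\}$, the probability being over the $(\xi_k,\eta_k)$, $k\le K$.
   Formalization: The second inequality, with ''≥'' inside Prob, is stated only for ℓ with R̃_ℓ[H_ℓ] > 0, since for R̃_ℓ[H_ℓ] = 0 the event is sure and the bound fails (e.g. B = 0, H_ℓ = 0, K ≥ 1); with strict ''>'' it is stated for every ℓ. *)

(* Defs.v *)
From HB Require Import structures.
From mathcomp Require Import all_boot all_order all_algebra.
From mathcomp Require Import all_classical all_reals all_analysis.

Set Implicit Arguments.
Unset Strict Implicit.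
Unset Printing Implicit Defensive.

Import Order.TTheory GRing.Theory Num.Theory.
Import numFieldNormedType.Exports.

Local Open Scope classical_set_scope.
Local Open Scope ring_scope.

Section Matrices.
Variable R : realType.

Definition psdmx (n : nat) (M : 'M[R]_n) : Prop :=
  M^T = M /\ forall u : 'cV[R]_n, 0 <= (u^T *m M *m u) 0 0.

Definition pdmx (n : nat) (M : 'M[R]_n) : Prop :=
  M^T = M /\ forall u : 'cV[R]_n, u != 0 -> 0 < (u^T *m M *m u) 0 0.

Definition loewner_le (n : nat) (M N : 'M[R]_n) : Prop := psdmx (N - M).

(* For psd M there is exactly one psd S with S *m S = M; outside the psd cone
   the value is irrelevant. *)
Definition sqrtmx (n : nat) (M : 'M[R]_n) : 'M[R]_n :=
  xget 0 [set S | psdmx S /\ S *m S = M].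

Definition fro_norm (m n : nat) (M : 'M[R]_(m, n)) : R :=
  Num.sqrt (\sum_i \sum_j M i j ^+ 2).

Definition enorm (n : nat) (u : 'cV[R]_n) : R := Num.sqrt (\sum_i u i 0 ^+ 2).

Definition nonneg_cV (n : nat) (u : 'cV[R]_n) : Prop := forall i, 0 <= u i 0.

Definition max_norm (nu L : nat) (Rm : 'I_L -> 'M[R]_nu) (u : 'cV[R]_nu) : R :=
  \big[Num.max/0]_(l < L) Num.sqrt ((u^T *m Rm l *m u) 0 0).

End Matrices.

Section Ellitopes.
Variable R : realType.
Variables (n J : nat).
Implicit Types (TT : set 'cV[R]_J) (Tm : 'I_J -> 'M[R]_n).

(* The interior is relative to the product topology on R^J. *)
Definition ellitope_data TT Tm : Prop :=
  [/\ forall j, psdmx (Tm j),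
      pdmx (\sum_j Tm j),
      [/\ forall t, TT t -> nonneg_cV t,
          convex_set TT,
          compact TT
        & interior TT !=set0]
    & forall t t' : 'cV[R]_J, TT t -> nonneg_cV t' ->
        (forall j, t' j 0 <= t j 0) -> TT t'].

Definition ellitope TT Tm : set 'cV[R]_n :=
  [set x | exists2 t, TT t & forall j, (x^T *m Tm j *m x) 0 0 <= t j 0].

Definition support_fun TT (y : 'cV[R]_J) : R :=
  sup [set (y^T *m u) 0 0 | u in TT].

End Ellitopes.

Section RiskBound.
Variable R : realType.
Variables (n m nu q J : nat).
Variables (TT : set 'cV[R]_J) (Tm : 'I_J -> 'M[R]_n).
Variables (B : 'M[R]_(nu, n)) (A : 'M[R]_(m, n)) (Aa : 'I_q -> 'M[R]_(m, n)).
Variables (sigma : R) (Rl : 'M[R]_nu) (H : 'M[R]_(m, nu)).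

Let S := sqrtmx Rl.

Definition risk_feasible (lam kap : R) (mu vkap : 'cV[R]_J) : Prop :=
  [/\ nonneg_cV mu,
      nonneg_cV vkap,
      psdmx (block_mx
        kap%:M                             (2^-1 *: (S *m (B - H^T *m A)))
        (2^-1 *: ((B - H^T *m A)^T *m S))  (\sum_j vkap j 0 *: Tm j))
    & psdmx (block_mx
        lam%:M
        (2^-1 *: \mxcol_(a < q) (S *m H^T *m Aa a))
        (2^-1 *: \mxrow_(a < q) ((Aa a)^T *m H *m S))
        (\sum_j mu j 0 *: Tm j))].

(* The minimum of the program: for ellitope data and nu, q > 0 it is attained,
   so it is the infimum of the objective over the feasible set. *)
Definition Rtilde : R :=
  inf [set v | exists lam kap mu vkap, risk_feasible lam kap mu vkap /\
         v = sigma * fro_norm (H *m S) + lam + support_fun TT mu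
             + kap + support_fun TT vkap].

End RiskBound.

Section Estimation.
Variable R : realType.

Definition perturbed (n m q : nat) (A : 'M[R]_(m, n))
    (Aa : 'I_q -> 'M[R]_(m, n)) (e : 'cV[R]_q) : 'M[R]_(m, n) :=
  A + \sum_(a < q) e a 0 *: Aa a.

Definition geometric_median (nu K : nat) (Rl : 'M[R]_nu)
    (w : 'I_K -> 'cV[R]_nu) (z : 'cV[R]_nu) : Prop :=
  forall z' : 'cV[R]_nu,
    \sum_(k < K) enorm (sqrtmx Rl *m (w k - z)) <=
    \sum_(k < K) enorm (sqrtmx Rl *m (w k - z')).

End Estimation.

Section Probability.
Context (R : realType) (d : measure_display) (Om : measurableType d).
Variable P : probability Om R.

(* Outer probability. The geometric medians and the aggregated estimate are
   arbitrary selections, so the events they define need not be measurable. *)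
Definition Prob (E : set Om) : \bar R := mu_ext P E.

Lemma Prob_measurable (E : set Om) : measurable E -> Prob E = P E.
Proof. exact: measurable_mu_extE. Qed.

Definition borel (U : topologicalType) : set (set U) := <<s @open U >>.

Definition random_element (U : topologicalType) (X : Om -> U) : Prop :=
  forall B : set U, borel B -> measurable (X @^-1` B).

(* Some of the sets B k may be the whole space, so the rule covers every
   subfamily. *)
Definition mutually_independent (U : topologicalType) (K : nat)
    (X : 'I_K -> Om -> U) : Prop :=
  forall B : 'I_K -> set U, (forall k, borel (B k)) ->
    P (\bigcap_k (X k @^-1` B k)) = (\prod_(k < K) P (X k @^-1` B k))%E.

Definition has_second_moment (m : nat) (X : Om -> 'cV[R]_m) : Prop :=
  forall i j, P.-integrable [set: Om]
    (fun w => ((X w *m (X w)^T) i j)%:E).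

Definition second_moment (m : nat) (X : Om -> 'cV[R]_m) : 'M[R]_m :=
  \matrix_(i, j) fine ('E_P[fun w => (X w *m (X w)^T) i j])%E.

(* est x is the estimate, as a function of the outcome, when the signal is x. *)
Definition eps_risk (n nu L : nat) (Rm : 'I_L -> 'M[R]_nu)
    (B : 'M[R]_(nu, n)) (XX : set 'cV[R]_n) (eps : R)
    (est : 'cV[R]_n -> Om -> 'cV[R]_nu) : \bar R :=
  ereal_sup [set ereal_inf [set rho%:E | rho in
      [set rho : R |
        (Prob [set w | (rho < max_norm Rm (B *m x - est x w))%R] <= eps%:E)%E]]
    | x in XX].

End Probability.

(* Main.v *)
(* Put D = |S(z - Bx)| with S = R_l^(1/2).  Moving the median z a quarter of the
   way towards Bx cannot decrease the sum of the distances to the w(omega_k).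
   By the law of cosines this step shortens by at least D/8 each distance to a
   point within 3D/4 of Bx, and it lengthens the others by at most D/4; hence
   at least K/3 of the points lie further than 3D/4 from Bx.  If D >= 4 Rtilde,
   each of these K independent events has probability at most 1/9, by Markov's
   inequality and the second moment bound, and Chernoff's inequality bounds the
   probability of K/3 of them by (8/9)^K <= exp(-0.107 K).

   For the second moment bound, the error S(H^T omega_k - Bx) is split into the
   bias S(H^T A - B)x, the part linear in eta_k and the part linear in xi_k.
   The two semidefinite constraints bound the Euclidean norm of the first and
   the Frobenius norm of the matrix of the second uniformly over the ellitope,
   and Minkowski's inequality in L2 adds the three contributions. *)

Require Import Defs.
From HB Require Import structures.
From mathcomp Require Import all_boot all_order all_algebra.
From mathcomp Require Import all_classical all_reals all_analysis.
From mathcomp Require Import measurable_realfun complex ring lra.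

Set Implicit Arguments.
Unset Strict Implicit.
Unset Printing Implicit Defensive.

Import Order.TTheory GRing.Theory Num.Theory.
Import numFieldNormedType.Exports.

Local Open Scope classical_set_scope.
Local Open Scope ring_scope.

(** * Square roots of semidefinite matrices *)

Lemma row_dot_ge0 (R : realType) n (v : 'rV[R]_n) : 0 <= (v *m v^T) 0 0.
Proof. by rewrite mxE sumr_ge0// => i _; rewrite mxE -expr2 sqr_ge0. Qed.

Lemma row_dot_gt0 (R : realType) n (v : 'rV[R]_n) : v != 0 ->
  0 < (v *m v^T) 0 0.
Proof.
move=> v0; rewrite lt_neqAle row_dot_ge0 andbT eq_sym.
apply: contra v0; rewrite mxE => /eqP/psumr_eq0P h.
apply/eqP/rowP => i; rewrite mxE; apply/eqP; rewrite -sqrf_eq0.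
have := h (fun i _ => _) i isT; rewrite mxE -expr2 => -> //= j.
by rewrite mxE -expr2 sqr_ge0.
Qed.

Lemma psdmx_eigenvalue_ge0 (R : realType) n (M : 'M[R]_n) (l : R) :
  psdmx M -> eigenvalue M l -> 0 <= l.
Proof.
move=> [_ Mge0] /eigenvalueP[v vM v0].
have := Mge0 v^T; rewrite trmxK vM -scalemxAl mxE.
by rewrite pmulr_lge0// row_dot_gt0.
Qed.

(** Over the complex numbers [M] is Hermitian, hence unitarily diagonalizable with real eigenvalues.
    An annihilating polynomial with simple real roots records this over [R], and the embedding of
    matrices is injective, so the identity descends. *)
Lemma sym_diagonalizable (R : realType) n (M : 'M[R]_n.+1) : M^T = M ->
  exists2 s : seq R, (forall l, l \in s -> eigenvalue M l) &
    uniq s /\ horner_mx M (\prod_(l <- s) ('X - l%:P)) = 0.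
Proof.
move=> Msym; pose f := real_complex R; pose A := map_mx f M.
have Aherm : A \is hermsymmx.
  apply/is_hermitianmxP; rewrite expr0 scale1r; apply/matrixP => i j.
  rewrite !mxE -[in LHS]Msym mxE.
  by rewrite conj_Creal// complex_real.
have Anormal := hermitian_normalmx Aherm.
have /orthomx_spectralP := Anormal.
set P := spectralmx A; set D := spectral_diag A => AE.
have Pu : P \in unitmx := spectral_unit A.
have PA : P *m A = diag_mx D *m P by rewrite AE !mulmxA mulmxV// mul1mx.
have Aeig j : eigenvalue A (D 0 j).
  apply/eigenvalueP; exists (row j P).
    rewrite -row_mul PA row_mul; apply/rowP => k.
    rewrite !mxE (bigD1 j)//= big1 ?addr0; last first.
      by move=> i ij; rewrite !mxE eq_sym (negbTE ij) mulr0n mul0r.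
    by rewrite !mxE eqxx mulr1n.
  apply: contraTneq Pu => P0; rewrite -row_free_unit.
  apply/negP => /row_freeP[Q PQ]; have := congr1 (row j) PQ.
  rewrite row_mul P0 mul0mx row1 => /rowP/(_ j).
  by rewrite !mxE !eqxx => /esym/eqP; rewrite oner_eq0.
have Dreal j : f (complex.Re (D 0 j)) = D 0 j.
  have /mxOverP/(_ 0 j) := hermitian_spectral_diag_real Aherm.
  by move=> h; rewrite /f/= RRe_real.
(* Repetitions are removed because interpolation and divisibility both require distinct nodes. *)
pose s := undup [seq complex.Re (D 0 j) | j : 'I_n.+1].
exists s.
  move=> l; rewrite mem_undup => /mapP[j _ ->].
  have := Aeig j; rewrite !eigenvalue_root_char -Dreal.
  by rewrite /A -map_char_poly fmorph_root.
split; first exact: undup_uniq.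
apply/(map_mx_inj (f := f)); rewrite map_mx0 map_horner_mx -/A.
set p := map_poly _ _.
have pD j : p.[D 0 j] = 0.
  rewrite -Dreal /p horner_map/=; apply/eqP; rewrite fmorph_eq0.
  rewrite -[_ == 0]/(root _ _) root_prod_XsubC mem_undup.
  by apply/mapP; exists j => //; rewrite mem_enum.
suff : P *m horner_mx A p = 0.
  by move=> /(congr1 (mulmx (invmx P))); rewrite mulmxA mulVmx// mul1mx mulmx0.
(* [P] intertwines [A] with the diagonal matrix, hence also their values under any polynomial, and
   [p] vanishes at every diagonal entry. *)
suff -> : P *m horner_mx A p = horner_mx (diag_mx D) p *m P.
  rewrite horner_mx_diag.
  have -> : map_mx (horner p) D = 0 by apply/rowP => j; rewrite !mxE pD.
  by rewrite linear0 mul0mx.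
elim/poly_ind: p {pD} => [|p c IH]; first by rewrite !rmorph0 mulmx0 mul0mx.
rewrite !rmorphD !rmorphM/= !horner_mx_X !horner_mx_C mulmxDr mulmxDl.
rewrite -scalar_mxC -!mulmxE mulmxA IH -!mulmxA PA.
by rewrite scalar_mxC.
Qed.

(** Newton's scheme: a multiple of the product vanishing at the earlier nodes corrects the value at
    the new one. *)
Lemma poly_interpolation (F : fieldType) (s : seq F) (g : F -> F) : uniq s ->
  exists p : {poly F}, forall a, a \in s -> p.[a] = g a.
Proof.
elim: s => [|a s IH]/=; first by exists 0.
move=> /andP[aNs us]; have [p pg] := IH us.
pose w := \prod_(b <- s) ('X - b%:P) : {poly F}.
have wa : w.[a] != 0 by rewrite -[_ == 0]/(root _ _) root_prod_XsubC.
exists (p + ((g a - p.[a]) / w.[a]) *: w) => b.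
rewrite inE hornerD hornerZ => /orP[/eqP->|bs].
  by rewrite divfK// addrC subrK.
have /rootP -> : root w b by rewrite root_prod_XsubC.
by rewrite mulr0 addr0 pg.
Qed.

Lemma psdmx_sqr (R : realType) n (Q : 'M[R]_n) : Q^T = Q -> psdmx (Q *m Q).
Proof.
move=> Qs; split=> [|u]; first by rewrite trmx_mul Qs.
have -> : u^T *m (Q *m Q) *m u = (Q *m u)^T *m (Q *m u)^T^T.
  by rewrite trmxK trmx_mul Qs !mulmxA.
exact: row_dot_ge0.
Qed.

(* [S] is the square of a polynomial in [M] interpolating the fourth root on
   the spectrum: this makes [S] symmetric and semidefinite at no cost. *)
Lemma psdmx_sqrt_exists (R : realType) n (M : 'M[R]_n) : psdmx M ->
  exists S : 'M[R]_n, psdmx S /\ S *m S = M.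
Proof.
case: n M => [|n] M Mpsd.
  by exists M; split=> //; apply/matrixP => -[].
have [s seig [us sM]] := sym_diagonalizable Mpsd.1.
have [q qE] := poly_interpolation (fun l => Num.sqrt (Num.sqrt l)) us.
have trq : (horner_mx M q)^T = horner_mx M q.
  rewrite -{2}Mpsd.1; elim/poly_ind: q {qE} => [|q c IH].
    by rewrite !rmorph0 trmx0.
  rewrite !rmorphD !rmorphM/= !horner_mx_X !horner_mx_C linearD/=.
  rewrite -!mulmxE trmx_mul tr_scalar_mx IH; congr (_ + _).
  by have := comm_horner_mx q (erefl (M^T *m M^T)).
exists (horner_mx M q *m horner_mx M q); split; first exact: psdmx_sqr.
(* Each eigenvalue [l] is nonnegative and [q] takes there the value of its fourth root, so
   [q ^+ 4 - 'X] vanishes on the spectrum and is a multiple of the annihilating polynomial. *)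
have : \prod_(l <- s) ('X - l%:P) %| q ^+ 4 - 'X.
  apply: uniq_roots_dvdp; last by rewrite uniq_rootsE.
  apply/allP => l ls; rewrite /root !hornerE qE//.
  by rewrite -[4%N]/(2 * 2)%N exprM !sqr_sqrtr ?sqrtr_ge0 ?subrr//;
    exact/(psdmx_eigenvalue_ge0 Mpsd)/seig.
move=> /dvdpP[r rE].
have : horner_mx M (q ^+ 4 - 'X) = 0 by rewrite rE rmorphM/= sM mulr0.
rewrite rmorphB/= horner_mx_X rmorphXn/= => /eqP; rewrite subr_eq0 => /eqP qM.
by rewrite !mulmxE -!expr2 -exprM.
Qed.

Lemma sqrtmxP (R : realType) n (M : 'M[R]_n) : psdmx M ->
  psdmx (sqrtmx M) /\ sqrtmx M *m sqrtmx M = M.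
Proof. by move=> /psdmx_sqrt_exists; exact: xgetPex. Qed.

(** * Euclidean norm and geometric medians *)

Lemma form11_sum (R : pzSemiRingType) n (u v : 'cV[R]_n) :
  (u^T *m v) 0 0 = \sum_i u i 0 * v i 0.
Proof. by rewrite mxE; apply: eq_bigr => i _; rewrite mxE. Qed.

Section EuclideanNorm.
Variable R : realType.
Implicit Types n p : nat.

Lemma enorm_ge0 n (u : 'cV[R]_n) : 0 <= enorm u.
Proof. exact: sqrtr_ge0. Qed.

Lemma enorm_sqr n (u : 'cV[R]_n) : enorm u ^+ 2 = \sum_i u i 0 ^+ 2.
Proof. by rewrite sqr_sqrtr// sumr_ge0// => i _; rewrite sqr_ge0. Qed.

Lemma enorm_sqr_form n (u : 'cV[R]_n) : enorm u ^+ 2 = (u^T *m u) 0 0.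
Proof. by rewrite enorm_sqr form11_sum; apply: eq_bigr. Qed.

Lemma enorm_sqrD n (u v : 'cV[R]_n) (c : R) :
  enorm (u + c *: v) ^+ 2 =
  enorm u ^+ 2 + 2 * c * \sum_i u i 0 * v i 0 + c ^+ 2 * enorm v ^+ 2.
Proof.
rewrite !enorm_sqr !mulr_sumr -!big_split/=.
by apply: eq_bigr => i _; rewrite !mxE; ring.
Qed.

Lemma cauchy_schwarz n (u v : 'cV[R]_n) :
  \sum_i u i 0 * v i 0 <= enorm u * enorm v.
Proof.
set d := \sum_i _.
have [v0|v0] := eqVneq (enorm v) 0.
  have vi i : v i 0 = 0.
    apply/eqP; rewrite -sqrf_eq0; apply/eqP.
    have : \sum_j v j 0 ^+ 2 = 0 by rewrite -enorm_sqr v0 expr0n.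
    by move/psumr_eq0P => -> // j _; rewrite sqr_ge0.
  by rewrite v0 mulr0 /d big1// => i _; rewrite vi mulr0.
have vgt0 : 0 < enorm v by rewrite lt_neqAle eq_sym v0 enorm_ge0.
(* This vector is the component of [u] orthogonal to [v]. *)
have := sqr_ge0 (enorm (u + (- (d / enorm v ^+ 2)) *: v)).
rewrite enorm_sqrD -/d => h.
have {h} : 0 <= enorm u ^+ 2 - d ^+ 2 / enorm v ^+ 2.
  by apply: (le_trans h); rewrite le_eqVlt; apply/orP; left; apply/eqP; field.
rewrite subr_ge0 ler_pdivrMr ?exprn_gt0// -exprMn => h.
have uv0 : 0 <= enorm u * enorm v by rewrite mulr_ge0 ?enorm_ge0.
have [d0|d0] := leP d 0; first exact: le_trans uv0.
by rewrite -(@ler_pXn2r _ 2)// nnegrE// ltW.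
Qed.

Lemma ler_enormD n (u v : 'cV[R]_n) : enorm (u + v) <= enorm u + enorm v.
Proof.
have uv0 : 0 <= enorm u + enorm v by rewrite addr_ge0 ?enorm_ge0.
rewrite -(@ler_pXn2r _ 2)// ?nnegrE ?enorm_ge0//.
rewrite -[X in u + X]scale1r enorm_sqrD.
by have := cauchy_schwarz u v; nra.
Qed.

Lemma enormZ n (c : R) (u : 'cV[R]_n) : enorm (c *: u) = `|c| * enorm u.
Proof.
rewrite /enorm -sqrtr_sqr -sqrtrM ?sqr_ge0// mulr_sumr.
by congr Num.sqrt; apply: eq_bigr => i _; rewrite mxE exprMn.
Qed.

Lemma enormN n (u : 'cV[R]_n) : enorm (- u) = enorm u.
Proof. by rewrite -scaleN1r enormZ normrN1 mul1r. Qed.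

Lemma enormB n (u v : 'cV[R]_n) : enorm (u - v) = enorm (v - u).
Proof. by rewrite -enormN opprB. Qed.

Lemma sqrt_form_sqrtmx n (M : 'M[R]_n) (u : 'cV[R]_n) : psdmx M ->
  Num.sqrt ((u^T *m M *m u) 0 0) = enorm (sqrtmx M *m u).
Proof.
move=> /sqrtmxP[[Ss _] SS].
rewrite -[RHS]ger0_norm ?enorm_ge0// -sqrtr_sqr enorm_sqr_form.
by rewrite trmx_mul Ss !mulmxA -(mulmxA u^T (sqrtmx M)) SS.
Qed.

(* The law of cosines: [e] points from [u] towards the ball of radius
   [3/4 |e|] around [e], so a step of length [|e| / 4] along [e] brings [u]
   closer to its target by at least half of the step. *)
Lemma enorm_step_decrease n (u e : 'cV[R]_n) :
  enorm (u - e) <= 3 / 4 * enorm e ->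
  enorm (u - 4^-1 *: e) <= enorm u - enorm e / 8.
Proof.
move=> h; have e0 := enorm_ge0 e.
have tri : enorm e <= enorm u + enorm (u - e).
  by rewrite enormB -[X in enorm X <= _](addrNK u e) addrC ler_enormD.
have a0 : 0 <= enorm u - enorm e / 8 by lra.
rewrite -(@ler_pXn2r _ 2)// ?nnegrE ?enorm_ge0//.
have h2 : enorm (u - e) ^+ 2 <= (3 / 4 * enorm e) ^+ 2.
  by rewrite ler_pXn2r// nnegrE ?enorm_ge0//; lra.
move: h2; rewrite -scaleN1r -scaleNr !enorm_sqrD.
set d := \sum_i _ => h2.
(* Once [d] is replaced by its lower bound from [h2], the two sides differ by exactly a quarter of
   this square. *)
have := sqr_ge0 (enorm u - enorm e / 2).
nra.
Qed.

Lemma geometric_median_outliers nu K (Rl : 'M[R]_nu) (w : 'I_K -> 'cV[R]_nu)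
    (z x : 'cV[R]_nu) (D := enorm (sqrtmx Rl *m (z - x))) :
  geometric_median Rl w z -> 0 < D ->
  (K <= 3 * #|[set k | (3 / 4 * D < enorm (sqrtmx Rl *m (w k - x)))%R]%SET|)%N.
Proof.
move=> zmed D0; set bad := [set k | _]%SET.
pose e := sqrtmx Rl *m (x - z).
have eD : enorm e = D by rewrite /e /D -[x - z]opprB mulmxN enormN.
pose u k := sqrtmx Rl *m (w k - z).
(* An outlier may lose [D / 4], written as [3 / 8 * D - D / 8] so that the gain [D / 8] is common to
   all points. Optimality of [z] then yields [K * D / 8 <= #|bad| * (3 / 8 * D)]. *)
have step k : enorm (u k - 4^-1 *: e) <=
    enorm (u k) + (k \in bad)%:R * (3 / 8 * D) - D / 8.
  rewrite inE; case: ltP => /= h.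
    have := ler_enormD (u k) (- (4^-1 *: e)).
    by rewrite enormN enormZ eD ger0_norm ?invr_ge0//; lra.
  have ue : u k - e = sqrtmx Rl *m (w k - x).
    by rewrite /u /e -mulmxBr; congr (_ *m _); rewrite opprB addrA subrK.
  have := @enorm_step_decrease _ (u k) e; rewrite ue eD => /(_ h).
  by rewrite mul0r addr0.
have := zmed (z + 4^-1 *: (x - z)).
under [X in _ <= X -> _]eq_bigr => k _.
  rewrite opprD addrA mulmxBr -scalemxAr -/(u k) -/e; over.
move=> /le_trans /(_ (ler_sum _ (fun k _ => step k))).
rewrite sumrB big_split/= -addrA lerDl sumr_const card_ord -mulr_suml.
have -> : \sum_k (k \in bad)%:R = #|bad|%:R :> R.
  by rewrite -natr_sum -sum1_card [in RHS]big_mkcond/=; congr _%:R;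
    apply: eq_bigr => k _; case: (_ \in _).
rewrite -[X in _ - X]mulr_natr.
rewrite subr_ge0 => h.
have {h} : K%:R <= 3 * #|bad|%:R :> R by nra.
by rewrite -natrM ler_nat.
Qed.

End EuclideanNorm.

(** * The semidefinite program *)

Section BlockForms.
Variable R : realType.
Implicit Types n p : nat.

Let mx11D (M N : 'M[R]_1) : (M + N) 0 0 = M 0 0 + N 0 0.
Proof. by rewrite mxE. Qed.

Let mx11Z (c : R) (M : 'M[R]_1) : (c *: M) 0 0 = c * M 0 0.
Proof. by rewrite mxE. Qed.

Lemma block_form p n (Ma : 'M[R]_p) (Mb : 'M[R]_(p, n)) (Mc : 'M[R]_(n, p))
    (Md : 'M[R]_n) (u : 'cV[R]_p) (x : 'cV[R]_n) :
  ((col_mx u x)^T *m block_mx Ma Mb Mc Md *m col_mx u x) 0 0 =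
  (u^T *m Ma *m u) 0 0 + (u^T *m Mb *m x) 0 0 +
  ((x^T *m Mc *m u) 0 0 + (x^T *m Md *m x) 0 0).
Proof.
rewrite tr_col_mx mul_row_block mul_row_col !mulmxDl.
by rewrite !mx11D addrACA.
Qed.

Lemma form11_tr p n (u : 'cV[R]_p) (N : 'M[R]_(p, n)) (x : 'cV[R]_n) :
  (x^T *m N^T *m u) 0 0 = (u^T *m N *m x) 0 0.
Proof.
by rewrite -[u in LHS]trmxK -mulmxA -trmx_mul -trmx_mul mxE.
Qed.

Lemma form_scalar_mx n (c : R) (u : 'cV[R]_n) :
  (u^T *m c%:M *m u) 0 0 = c * enorm u ^+ 2.
Proof. by rewrite mul_mx_scalar -scalemxAl mxE enorm_sqr_form. Qed.

(** With [v = N *m x], the form is tested at the pair of [- v / enorm v] and [x]: the two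
    off-diagonal halves add up to [- enorm v]. The sign of [c] comes from a basis vector, available
    since [p] is positive. *)
Lemma psdmx_block_enorm p n (c : R) (N : 'M[R]_(p, n)) (N' : 'M[R]_(n, p))
    (Q : 'M[R]_n) (x : 'cV[R]_n) : (0 < p)%N ->
  psdmx (block_mx c%:M (2^-1 *: N) N' Q) ->
  0 <= c /\ enorm (N *m x) <= c + (x^T *m Q *m x) 0 0.
Proof.
move=> p0 [sym pos].
have NE : N' = (2^-1 *: N)^T.
  by move: sym; rewrite tr_block_mx => /eq_block_mx[_ _ <- _].
rewrite {}NE in pos => {sym}.
have {}pos (u : 'cV_p) (y : 'cV_n) :
    0 <= c * enorm u ^+ 2 + (u^T *m N *m y) 0 0 + (y^T *m Q *m y) 0 0.
  have := pos (col_mx u y); rewrite block_form form11_tr form_scalar_mx.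
  by rewrite -scalemxAr -scalemxAl mx11Z; lra.
have c0 : 0 <= c.
  have := pos (delta_mx (Ordinal p0) 0) 0.
  rewrite !mulmx0 mxE !addr0 enorm_sqr (bigD1 (Ordinal p0))//=.
  rewrite big1 => [|i /negbTE ip]; last by rewrite mxE ip expr0n.
  by rewrite mxE !eqxx expr1n addr0 mulr1.
have Q0 : 0 <= (x^T *m Q *m x) 0 0.
  have := pos 0 x.
  rewrite trmx0 !mul0mx mxE addr0 enorm_sqr big1 ?mulr0 ?add0r// => i _.
  by rewrite mxE expr0n.
split=> //; set v := N *m x.
have [->|v0] := eqVneq (enorm v) 0; first by rewrite addr_ge0.
have := pos (- (enorm v)^-1 *: v) x.
rewrite enormZ linearZ/= -!scalemxAl mx11Z -mulmxA -/v.
rewrite -enorm_sqr_form exprMn real_normK ?num_real// sqrrN.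
rewrite exprVn mulVf ?expf_neq0// mulr1 mulNr expr2 mulKf//; lra.
Qed.

(** A crude entrywise bound, from [2 |u_i u_j| <= u_i^2 + u_j^2]; it only has to provide some finite
    constant. *)
Lemma form_bound n (Q : 'M[R]_n) (u : 'cV[R]_n) :
  (u^T *m Q *m u) 0 0 <= (\sum_i \sum_j `|Q i j|) * enorm u ^+ 2.
Proof.
rewrite -mulmxA form11_sum mulr_suml; apply: ler_sum => i _.
rewrite mxE mulr_suml mulr_sumr; apply: ler_sum => j _.
rewrite enorm_sqr; have uk k : u k 0 ^+ 2 <= \sum_i u i 0 ^+ 2.
  by rewrite (bigD1 k)//= lerDl sumr_ge0// => a _; rewrite sqr_ge0.
have := uk i; have := uk j; move: (\sum_(i < n) _) => s uj ui.
rewrite mulrCA (le_trans (ler_norm _))// !normrM ler_wpM2l//.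
rewrite -(@real_normK _ (u i 0)) ?num_real// in ui.
rewrite -(@real_normK _ (u j 0)) ?num_real// in uj.
have := sqr_ge0 (`|u i 0| - `|u j 0|); nra.
Qed.

Lemma pdmx_unit n (Q : 'M[R]_n) : pdmx Q -> Q \in unitmx.
Proof.
move=> [_ Qpos]; rewrite -row_free_unit -kermx_eq0.
apply/rowV0P => v /sub_kermxP vQ; apply/eqP/contraT => v0.
have := Qpos v^T; rewrite trmxK vQ mul0mx mxE ltxx => -> //.
by apply: contra v0 => /eqP/(congr1 trmx); rewrite trmxK trmx0 => ->.
Qed.

(** Schur complement: completing the square in [x] leaves [c * enorm u ^+ 2] minus a quarter of the
    form of [N *m invmx Q *m N^T], which a large [c] dominates. *)
Lemma pdmx_block_psd p n (N : 'M[R]_(p, n)) (Q : 'M[R]_n) : pdmx Q ->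
  exists c, psdmx (block_mx c%:M (2^-1 *: N) (2^-1 *: N^T) Q).
Proof.
move=> Qpd; have Qu := pdmx_unit Qpd; have [Qs Qpos] := Qpd.
pose W := N *m invmx Q *m N^T.
exists (4^-1 * \sum_i \sum_j `|W i j|); split=> [|w].
  by rewrite tr_block_mx !linearZ/= trmxK tr_scalar_mx Qs.
rewrite -[w]vsubmxK; move: (usubmx w) (dsubmx w) => u x {w}.
rewrite block_form form_scalar_mx -!scalemxAr -!scalemxAl.
rewrite !mx11Z form11_tr.
have := form_bound W u; set b := \sum_i _ => Wb.
have : 0 <= ((x + 2^-1 *: (invmx Q *m N^T *m u))^T *m Q *m
             (x + 2^-1 *: (invmx Q *m N^T *m u))) 0 0.
  have [->|/Qpos/ltW//] := eqVneq (x + 2^-1 *: (invmx Q *m N^T *m u)) 0.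
  by rewrite mulmx0 mxE.
have -> : (x + 2^-1 *: (invmx Q *m N^T *m u))^T =
    x^T + 2^-1 *: (u^T *m N *m invmx Q).
  by rewrite linearD linearZ/= !trmx_mul trmxK trmx_inv Qs mulmxA.
rewrite !mulmxDl !mulmxDr -!scalemxAl -!scalemxAr.
rewrite !mulmxA !(mulmxKV Qu) (mulmxK Qu).
rewrite !mx11D !mx11Z.
rewrite form11_tr -!mulmxA -/W.
move=> h; move: Wb; rewrite /W !mulmxA in h * => Wb.
lra.
Qed.

End BlockForms.

Lemma continuous_addr (R : realType) (T : topologicalType) (f g : T -> R) :
  continuous f -> continuous g -> continuous (fun x => f x + g x).
Proof. by move=> cf cg x; exact: (continuousD (cf x) (cg x)). Qed.

Lemma continuous_mulr (R : realType) (T : topologicalType) (f g : T -> R) :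
  continuous f -> continuous g -> continuous (fun x => f x * g x).
Proof. by move=> cf cg x; exact: (continuousM (cf x) (cg x)). Qed.

Lemma continuous_sumr (R : realType) (T : topologicalType) (I : finType)
    (F : I -> T -> R) :
  (forall i, continuous (F i)) -> continuous (fun x => \sum_i F i x).
Proof.
move=> cF; apply: continuous_big => [z|i _]; last exact: cF.
by apply: cvgD; [exact: cvg_fst|exact: cvg_snd].
Qed.

Section RiskProgram.
Variables (R : realType) (n m nu q J : nat).
Variables (TT : set 'cV[R]_J) (Tm : 'I_J -> 'M[R]_n).
Hypothesis hT : ellitope_data TT Tm.

(** [sup] is an upper bound only of a bounded set; compactness of [TT] and continuity of the linear
    form ensure boundedness. *)
Lemma support_fun_ge (y t : 'cV[R]_J) : TT t -> (y^T *m t) 0 0 <= support_fun TT y.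
Proof.
move=> TTt; have [_ _ [_ _ cTT _] _] := hT.
pose f (u : 'cV[R]_J) : R := (y^T *m u) 0 0.
have cf : continuous f.
  have -> : f = fun u => \sum_i y i 0 * u i 0.
    by apply: funext => u; rewrite /f form11_sum.
  apply: continuous_sumr => i.
  by apply: continuous_mulr; [exact: cst_continuous|exact: coord_continuous].
have fTT0 : [set f u | u in TT] !=set0 by exists (f t), t.
have /(compact_has_sup fTT0) : compact [set f u | u in TT].
  by apply: continuous_compact => //; exact: continuous_subspaceT.
by move=> /sup_upper_bound; apply; exists t.
Qed.

Lemma support_fun_ge0 (y : 'cV[R]_J) : nonneg_cV y -> 0 <= support_fun TT y.
Proof.
move=> y0; have [_ _ [TT0 _ _ [t /interior_subset TTt]] _] := hT.
apply: le_trans (support_fun_ge y TTt).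
by rewrite form11_sum sumr_ge0// => i _; rewrite mulr_ge0// TT0.
Qed.

Lemma ellitope_form_le (y : 'cV[R]_J) (x : 'cV[R]_n) :
  nonneg_cV y -> ellitope TT Tm x ->
  (x^T *m (\sum_j y j 0 *: Tm j) *m x) 0 0 <= support_fun TT y.
Proof.
move=> y0 [t TTt xt]; apply: le_trans (support_fun_ge y TTt).
rewrite mulmx_sumr mulmx_suml summxE form11_sum; apply: ler_sum => j _.
by rewrite -scalemxAr -scalemxAl mxE ler_wpM2l.
Qed.

Variables (B : 'M[R]_(nu, n)) (A : 'M[R]_(m, n)) (Aa : 'I_q -> 'M[R]_(m, n)).
Variables (sigma : R) (Rl : 'M[R]_nu) (H : 'M[R]_(m, nu)).
Hypotheses (nu_gt0 : (0 < nu)%N) (q_gt0 : (0 < q)%N).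
Hypotheses (sigma_ge0 : 0 <= sigma) (Rlpsd : psdmx Rl).

Let S := sqrtmx Rl.
Let feasible := risk_feasible Tm B A Aa Rl H.

(** Multipliers all equal to 1 turn the lower right corners into the positive definite sum of the
    [Tm j], so large diagonal constants complete a feasible point. *)
Lemma risk_feasible_exists : exists lam kap mu vkap, feasible lam kap mu vkap.
Proof.
have [_ Tpd _ _] := hT; have [[Ss _] _] := sqrtmxP Rlpsd.
have [kap kapP] := pdmx_block_psd (S *m (B - H^T *m A)) Tpd.
have [lam lamP] := pdmx_block_psd (\mxcol_(a < q) (S *m H^T *m Aa a)) Tpd.
have one1 : \sum_j (const_mx 1 : 'cV[R]_J) j 0 *: Tm j = \sum_j Tm j.
  by apply: eq_bigr => j _; rewrite mxE scale1r.
exists lam, kap, (const_mx 1), (const_mx 1); rewrite /feasible /risk_feasible.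
rewrite !one1; split; [by move=> j; rewrite mxE|by move=> j; rewrite mxE| |].
  by move: kapP; rewrite trmx_mul Ss.
move: lamP; rewrite tr_mxcol; congr (psdmx (block_mx _ _ (_ *: _) _)).
by apply: eq_mxrow => a; rewrite !trmx_mul trmxK Ss mulmxA.
Qed.

Lemma risk_feasible_bias lam kap mu vkap (x : 'cV[R]_n) :
  feasible lam kap mu vkap -> ellitope TT Tm x ->
  enorm (S *m (B - H^T *m A) *m x) <= kap + support_fun TT vkap.
Proof.
move=> [_ vk0 /(psdmx_block_enorm x nu_gt0)[_ h] _] xX.
by rewrite (le_trans h)// lerD2l; exact: ellitope_form_le.
Qed.

Lemma enorm_mxcol (p : nat) (p_ : 'I_p -> nat) (V : forall a, 'cV[R]_(p_ a)) :
  enorm (\mxcol_a V a) ^+ 2 = \sum_a enorm (V a) ^+ 2.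
Proof.
rewrite enorm_sqr_form tr_mxcol mul_mxrow_mxcol summxE.
by apply: eq_bigr => a _; rewrite enorm_sqr_form.
Qed.

(** The factor of [eta_k] in the error. Its Frobenius norm is the Euclidean norm of its stacked
    columns, the quantity controlled by the second constraint. *)
Let perturbation_mx (x : 'cV[R]_n) : 'M[R]_(nu, q) :=
  \matrix_(i, a) (S *m H^T *m Aa a *m x) i 0.

Lemma sum_dim_gt0 : (0 < \sum_(a < q) nu)%N.
Proof. by rewrite sum_nat_const card_ord muln_gt0 q_gt0. Qed.

Lemma risk_feasible_perturbation lam kap mu vkap (x : 'cV[R]_n) :
  feasible lam kap mu vkap -> ellitope TT Tm x ->
  fro_norm (perturbation_mx x) <= lam + support_fun TT mu.
Proof.
move=> [mu0 _ _ /(psdmx_block_enorm x sum_dim_gt0)[_ h]] xX.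
have -> : fro_norm (perturbation_mx x) =
    enorm ((\mxcol_(a < q) (S *m H^T *m Aa a)) *m x).
  rewrite -[RHS]ger0_norm ?enorm_ge0// -sqrtr_sqr mxcol_mul enorm_mxcol.
  rewrite /fro_norm exchange_big/=; congr Num.sqrt; apply: eq_bigr => a _.
  by rewrite enorm_sqr; apply: eq_bigr => i _; rewrite mxE.
by rewrite (le_trans h)// lerD2l; exact: ellitope_form_le.
Qed.

Lemma risk_feasible_ge0 lam kap mu vkap : feasible lam kap mu vkap ->
  [/\ 0 <= lam, 0 <= kap, 0 <= support_fun TT mu & 0 <= support_fun TT vkap].
Proof.
move=> [mu0 vk0 /(psdmx_block_enorm 0 nu_gt0)[k0 _]].
by move=> /(psdmx_block_enorm 0 sum_dim_gt0)[l0 _]; split => //;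
  exact: support_fun_ge0.
Qed.

(** Risk bounds are proved at each feasible point and passed to the infimum here; feasibility
    matters because [inf] of the empty set is a default value. *)
Lemma le_Rtilde (r : R) :
  (forall lam kap mu vkap, feasible lam kap mu vkap ->
     r <= sigma * fro_norm (H *m S) + lam + support_fun TT mu
          + kap + support_fun TT vkap) ->
  r <= Rtilde TT Tm B A Aa sigma Rl H.
Proof.
move=> h; apply: lb_le_inf.
  have [lam [kap [mu [vkap f]]]] := risk_feasible_exists.
  by eexists; exists lam, kap, mu, vkap; split; first exact: f.
by move=> _ [lam [kap [mu [vkap [f ->]]]]]; exact: h.
Qed.

Lemma Rtilde_ge0 : 0 <= Rtilde TT Tm B A Aa sigma Rl H.
Proof.
apply: le_Rtilde => lam kap mu vkap /risk_feasible_ge0[l0 k0 m0 v0].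
by rewrite !addr_ge0// mulr_ge0// sqrtr_ge0.
Qed.

End RiskProgram.

(** * Second moments and independent trials *)

Section Moments.
Context (R : realType) (d : measure_display) (Om : measurableType d).
Variable P : probability Om R.

(** Integrability and a finite value are kept together, so linearity applies without separate
    finiteness conditions. *)
Definition has_mean (f : Om -> R) (r : R) : Prop :=
  P.-integrable [set: Om] (EFin \o f) /\ (\int[P]_w (f w)%:E)%E = r%:E.

Lemma has_meanZ (c r : R) (f : Om -> R) :
  has_mean f r -> has_mean (fun w => c * f w) (c * r).
Proof.
move=> [fi fr]; split; first exact: (integrableZl measurableT c fi).
under eq_integral do rewrite EFinM.
by rewrite (integralZl measurableT fi) fr.
Qed.

Lemma has_mean_sum (I : finType) (f : I -> Om -> R) (r : I -> R) :
  (forall i, has_mean (f i) (r i)) ->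
  has_mean (fun w => \sum_i f i w) (\sum_i r i).
Proof.
move=> fr; have fi i := (fr i).1; split.
  have -> : EFin \o (fun w => \sum_i f i w) = fun w => (\sum_i (f i w)%:E)%E.
    by apply: funext => w; rewrite /= sumEFin.
  exact: (@integrable_sum _ _ _ P setT measurableT I _ _ (fun i => EFin \o f i)
    (fun i _ => fi i)).
under eq_integral do rewrite -sumEFin.
rewrite (integral_sum measurableT fi) -sumEFin.
by apply: eq_bigr => i _; exact: (fr i).2.
Qed.

Lemma has_meanD (f g : Om -> R) (r s : R) :
  has_mean f r -> has_mean g s -> has_mean (fun w => f w + g w) (r + s).
Proof.
move=> [fi fr] [gi gs]; split; first exact: (integrableD measurableT fi gi).
under eq_integral do rewrite EFinD.
by rewrite (integralD measurableT fi gi) fr gs.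
Qed.

Lemma has_mean_cst (r : R) : has_mean (cst r) r.
Proof.
split; first exact: finite_measure_integrable_cst.
rewrite [LHS](integral_cst P measurableT r%:E).
by rewrite [X in (_ * X)%E]probability_setT mule1.
Qed.

(** The trace of [G V G^T], with [V] the second moment matrix, is written row by row so that a
    semidefinite bound on [V] can be tested at each row of [G]. *)
Lemma second_moment_quadratic p m (X : Om -> 'cV[R]_m) (G : 'M[R]_(p, m)) :
  has_second_moment P X ->
  has_mean (fun w => enorm (G *m X w) ^+ 2)
    (\sum_a (row a G *m second_moment P X *m (row a G)^T) 0 0).
Proof.
move=> X2.
have XX i j : has_mean (fun w => (X w *m (X w)^T) i j) (second_moment P X i j).
  split; first exact: X2.
  by rewrite mxE unlock fineK//; exact: (integrable_fin_num measurableT (X2 i j)).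
have -> : (fun w => enorm (G *m X w) ^+ 2) = fun w => \sum_a \sum_j \sum_i
    G a i * G a j * (X w *m (X w)^T) i j.
  apply: funext => w; rewrite enorm_sqr; apply: eq_bigr => a _.
  rewrite mxE expr2 big_distrlr/= exchange_big/=.
  apply: eq_bigr => j _; apply: eq_bigr => i _.
  by rewrite mxE big_ord1 mxE mulrACA.
have -> : \sum_a (row a G *m second_moment P X *m (row a G)^T) 0 0 =
    \sum_a \sum_j \sum_i G a i * G a j * second_moment P X i j.
  apply: eq_bigr => a _; rewrite mxE; apply: eq_bigr => j _.
  rewrite mxE mulr_suml; apply: eq_bigr => i _.
  by rewrite !mxE mulrAC.
apply: has_mean_sum => a; apply: has_mean_sum => j; apply: has_mean_sum => i.
exact: has_meanZ.
Qed.

Lemma loewner_row_bound p m (c : R) (V : 'M[R]_m) (G : 'M[R]_(p, m)) :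
  loewner_le V (c *: 1%:M) ->
  \sum_a (row a G *m V *m (row a G)^T) 0 0 <= c * fro_norm G ^+ 2.
Proof.
move=> [_ cV].
rewrite sqr_sqrtr; last by do 2 (apply: sumr_ge0 => ? _); exact: sqr_ge0.
rewrite mulr_sumr; apply: ler_sum => a _.
have := cV (row a G)^T; rewrite trmxK mulmxBr mulmxBl -scalemxAr mulmx1 -scalemxAl.
set N := row a G *m V *m _; set D := row a G *m (row a G)^T.
have -> : (c *: D - N) 0 0 = c * D 0 0 - N 0 0 by rewrite !mxE.
rewrite subr_ge0 => /le_trans; apply.
rewrite /D mxE le_eqVlt; apply/orP; left; apply/eqP; congr (_ * _).
by apply: eq_bigr => i _; rewrite !mxE.
Qed.

Lemma measurable_continuous_comp (U : topologicalType) (X : Om -> U) (f : U -> R) :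
  random_element X -> continuous f -> measurable_fun [set: Om] (f \o X).
Proof.
move=> Xm /continuousP cf.
apply: (measurability _ (RGenOInfty.measurableE R)) => _ [_ [r ->] <-].
rewrite setTI comp_preimage; apply: Xm; apply: sub_sigma_algebra.
by apply: cf; exact: interval_open.
Qed.

Lemma markov_square (f : Om -> R) (r : R) : measurable_fun [set: Om] f ->
  (forall w, 0 <= f w) -> 0 <= r -> (\int[P]_w (f w)%:E <= (r ^+ 2)%:E)%E ->
  (P [set w | (9 * r ^+ 2 < f w)%R] <= (9^-1)%:E)%E.
Proof.
move=> fm f0 r0 fr; set E := [set w | _].
have fmE := (measurable_EFinP [set: Om] f).2 fm.
have mE : measurable E.
  rewrite /E -[X in measurable X]setTI.
  have -> : [set w | 9 * r ^+ 2 < f w] = f @^-1` `]9 * r ^+ 2, +oo[%classic.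
    by apply/seteqP; split => w /=; rewrite in_itv/= andbT.
  exact: fm.
(* For [r = 0] Markov's inequality degenerates; instead the vanishing integral forces [f] to vanish
   almost everywhere. *)
have [r00|rn0] := eqVneq r 0.
  suff -> : P E = 0%E by rewrite lee_fin invr_ge0.
  have : (\int[P]_w `|(f w)%:E| = 0)%E.
    apply/eqP; rewrite eq_le integral_ge0// andbT.
    rewrite r00 expr0n/= in fr; apply: le_trans fr.
    rewrite (_ : (fun w => `|(f w)%:E|)%E = fun w => (f w)%:E)//.
    by apply: funext => w; rewrite gee0_abs// lee_fin.
  move=> /(ae_eq_integral_abs _ measurableT fmE)[N [mN PN subN]].
  apply/eqP; rewrite -measure_le0 -PN le_measure ?inE// => w wE.
  apply: subN => /(_ I) [fw]; move: wE.
  by rewrite /E/= fw r00 expr0n mulr0 ltxx.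
have r2 : 0 < 9 * r ^+ 2 by rewrite mulr_gt0// exprn_gt0// lt_neqAle eq_sym rn0.
have : ((9 * r ^+ 2)%:E * P E <= (r ^+ 2)%:E)%E.
  apply: le_trans fr; rewrite -(integral_cst P mE).
  apply: (@le_trans _ _ (\int[P]_(w in E) (f w)%:E)%E).
    apply: ge0_le_integral => //=.
    - by move=> w _; rewrite lee_fin ltW.
    - exact: measurable_funTS.
    - by move=> w wE; rewrite lee_fin ltW.
  by apply: ge0_subset_integral => //= w _; rewrite lee_fin.
have PE := @fin_num_measure _ _ _ P E mE.
rewrite -[P E]fineK//; move: (fine _) => p.
rewrite -EFinM !lee_fin => h.
rewrite -(ler_pM2l r2) (le_trans h)// le_eqVlt; apply/orP; left; apply/eqP.
by field.
Qed.

End Moments.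

Section IndependentTrials.
Context (R : realType) (d : measure_display) (Om : measurableType d).
Variable P : probability Om R.

Lemma le_measure_bigsetU (I : finType) (Q : pred I) (A : I -> set Om) :
  (forall i, measurable (A i)) ->
  (P (\big[setU/set0]_(i | Q i) A i) <= \sum_(i | Q i) P (A i))%E.
Proof.
move=> mA; elim: (index_enum I) => [|i s IH]; first by rewrite !big_nil measure0.
rewrite !big_cons; case: ifP => // _.
apply: (le_trans (measureU2 _ (mA i) _)); last exact: leeD2l.
exact: bigsetU_measurable.
Qed.

(* Chernoff's method with the factor [8] for each success: splitting according
   to the exact set of successes, independence turns the sum of the weighted
   probabilities into [\prod_k (8 p_k + (1 - p_k))]. *)
Lemma third_successes_bound (U : topologicalType) (K : nat) (X : 'I_K -> Om -> U)
    (D : 'I_K -> set U) :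
  (forall k, random_element (X k)) -> mutually_independent P X ->
  (forall k, borel (D k)) -> (forall k, P (X k @^-1` D k) <= (9^-1)%:E)%E ->
  exists2 E : set Om, measurable E &
    (forall w, (K <= 3 * #|[set k | `[< D k (X k w) >]]%SET|)%N -> E w) /\
    (P E <= (expR (- (107 / 1000) * K%:R))%:E)%E.
Proof.
move=> Xm Xind Db PD.
(* [f] is a success pattern, and [F f] below is the event that the successes are exactly those of
   [f]. *)
pose C (f : {ffun 'I_K -> bool}) k := if f k then D k else ~` D k.
have Cb f k : borel (C f k).
  rewrite /C; case: (f k) => //=.
  have [_ h _] := smallest_sigma_algebra setT (@open U).
  by rewrite -setTD; exact: (h _ (Db k)).
pose F f := \bigcap_k (X k @^-1` C f k).
have mF f : measurable (F f).
  by apply: fin_bigcap_measurable => // k _; exact: Xm.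
pose many (f : {ffun 'I_K -> bool}) := (K <= 3 * #|[set k | f k]%SET|)%N.
exists (\big[setU/set0]_(f | many f) F f); first exact: bigsetU_measurable.
split.
  move=> w Kw; pose f := [ffun k => `[< D k (X k w) >]].
  have fE : [set k | `[< D k (X k w) >]]%SET = [set k | f k]%SET.
    by apply/setP => k; rewrite !inE ffunE.
  rewrite (bigD1 f) /=; last by rewrite /many -fE.
  left=> k _; rewrite /C /= ffunE.
  by case: asboolP.
pose p k := fine (P (X k @^-1` D k)).
have mD k : measurable (X k @^-1` D k) by exact: Xm.
have pE k : P (X k @^-1` D k) = (p k)%:E by rewrite fineK// fin_num_measure.
have p0 k : 0 <= p k by rewrite -lee_fin -pE measure_ge0.
have p9 k : p k <= 9^-1 by rewrite -lee_fin -pE.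
have PC f k : P (X k @^-1` C f k) = (if f k then p k else 1 - p k)%:E.
  rewrite /C; case: (f k) => //=.
  by rewrite preimage_setC (probability_setC P (mD k)) pE.
apply: (le_trans (@le_measure_bigsetU _ many F mF)).
have PF f : P (F f) = (\prod_k (if f k then p k else 1 - p k))%:E.
  by rewrite (Xind _ (Cb f)) -prodEFin; apply: eq_bigr => k _; rewrite PC.
under eq_bigr do rewrite PF.
rewrite sumEFin lee_fin.
(* A pattern with [N] successes gets the weight [8 ^+ N / 2 ^+ K], at least 1 when [K <= 3 * N]; the
   remaining patterns add nonnegative terms. *)
apply: (@le_trans _ _ (\sum_(f : {ffun 'I_K -> bool})
    \prod_k ((if f k then 8 * p k else 1 - p k) / 2))).
  rewrite big_mkcond/=; apply: ler_sum => f _.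
  have pos k : 0 <= (if f k then p k else 1 - p k).
    by case: (f k) => //; have := p9 k; lra.
  case: ifPn => [Kf|_]; last first.
    by apply: prodr_ge0 => k _; case: (f k); have := p9 k; have := p0 k; lra.
  pose N := #|[set k | f k]%SET|.
  have -> : \prod_k ((if f k then 8 * p k else 1 - p k) / 2) =
      8 ^+ N / 2 ^+ K * \prod_k (if f k then p k else 1 - p k).
    have -> : (8 : R) ^+ N = \prod_k (if f k then 8 else 1).
      rewrite -big_mkcond/= prodr_const; congr (_ ^+ _).
      by apply: eq_card => k; rewrite inE.
    rewrite -exprVn.
    have -> : (2^-1 : R) ^+ K = \prod_(k < K) 2^-1 by rewrite prodr_const card_ord.
    rewrite -!big_split/=; apply: eq_bigr => k _.
    by case: (f k) => /=; field.
  rewrite ler_peMl ?prodr_ge0// ler_pdivlMr ?exprn_gt0// mul1r.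
  rewrite -[8]/((2 ^ 3)%:R) natrX -exprM ler_eXn2l//.
  by rewrite ltr1n.
rewrite -(bigA_distr_bigA (fun k (b : bool) =>
  (if b then 8 * p k else 1 - p k) / 2)).
rewrite expRM_natr -[X in _ ^+ X]card_ord -prodr_const.
apply: ler_prod => k _; rewrite big_bool/=.
(* For [p <= 1/9] the factor [(8 * p + (1 - p)) / 2] is at most [8/9], which is below
   [1 - 107/1000], hence below [expR (- (107 / 1000))]. *)
have := p9 k; have := p0 k; have := expR_ge1Dx (- (107 / 1000) : R).
by move=> *; apply/andP; split; lra.
Qed.

End IndependentTrials.

(** * Error bounds *)

Lemma fro_norm_tr (R : realType) p n (M : 'M[R]_(p, n)) :
  fro_norm M^T = fro_norm M.
Proof.
rewrite /fro_norm exchange_big/=; congr Num.sqrt.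
by do 2 (apply: eq_bigr => ? _); rewrite mxE.
Qed.

(* Cauchy-Schwarz in the form that, integrated, gives Minkowski's inequality
   without square roots of expectations. *)
Lemma enorm_sqrD3_weighted (R : realType) n (u v w : 'cV[R]_n) (a b c : R) :
  0 < a -> 0 < b -> 0 < c ->
  enorm (u + v + w) ^+ 2 <=
  (a + b + c) * (a^-1 * enorm u ^+ 2 + (b^-1 * enorm v ^+ 2 + c^-1 * enorm w ^+ 2)).
Proof.
move=> a0 b0 c0; rewrite !enorm_sqr !mulr_sumr -!big_split/= mulr_sumr.
apply: ler_sum => i _; rewrite !mxE.
move: (u i 0) (v i 0) (w i 0) => x y z.
have xE : x = a * (x / a) by rewrite mulrC divfK// gt_eqF.
have yE : y = b * (y / b) by rewrite mulrC divfK// gt_eqF.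
have zE : z = c * (z / c) by rewrite mulrC divfK// gt_eqF.
move: (x / a) (y / b) (z / c) xE yE zE => x' y' z' -> -> ->.
have red (t s : R) : 0 < t -> t^-1 * (t * s) ^+ 2 = t * s ^+ 2.
  by move=> t0; field; rewrite gt_eqF.
rewrite !red// -subr_ge0.
(* Lagrange's identity: the deficit is a weighted sum of squared pairwise differences. *)
have -> : (a + b + c) * (a * x' ^+ 2 + (b * y' ^+ 2 + c * z' ^+ 2)) -
    (a * x' + b * y' + c * z') ^+ 2 =
    a * b * (x' - y') ^+ 2 + a * c * (x' - z') ^+ 2 + b * c * (y' - z') ^+ 2.
  by ring.
have ab := mulr_gt0 a0 b0; have ac := mulr_gt0 a0 c0; have bc := mulr_gt0 b0 c0.
by rewrite !addr_ge0// mulr_ge0 ?sqr_ge0// ltW.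
Qed.

Section EstimationError.
Variables (R : realType) (n m nu q : nat).
Variables (B : 'M[R]_(nu, n)) (A : 'M[R]_(m, n)) (Aa : 'I_q -> 'M[R]_(m, n)).
Variables (S : 'M[R]_nu) (H : 'M[R]_(m, nu)) (x : 'cV[R]_n).

(** A function of the noise pair rather than of the outcome, so that error events are preimages of
    Borel sets and independence of the pairs applies. *)
Definition estimation_error (p : 'cV[R]_m * 'cV[R]_q) : 'cV[R]_nu :=
  S *m (H^T *m (perturbed A Aa p.2 *m x + p.1) - B *m x).

Lemma estimation_errorE p : estimation_error p =
  - (S *m (B - H^T *m A) *m x)
  + (\matrix_(i, a) (S *m H^T *m Aa a *m x) i 0) *m p.2 + S *m H^T *m p.1.
Proof.
have pert : S *m H^T *m (\sum_(a < q) p.2 a 0 *: Aa a) *m x =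
    (\matrix_(i, a) (S *m H^T *m Aa a *m x) i 0) *m p.2.
  apply/matrixP => i k; rewrite ord1 mulmx_sumr mulmx_suml summxE mxE.
  by apply: eq_bigr => a _; rewrite -scalemxAr -scalemxAl !mxE mulrC.
rewrite /estimation_error /perturbed.
rewrite !(mulmxDl, mulmxDr, mulmxN, mulNmx, mulmxA) pert opprD opprK.
by rewrite addrC !addrA.
Qed.

Lemma continuous_estimation_error :
  continuous (fun p => enorm (estimation_error p) ^+ 2).
Proof.
have cfst j : continuous (fun p : 'cV[R]_m * 'cV[R]_q => p.1 j 0).
  by move=> p; exact: (@continuous_comp _ _ _ fst (fun v : 'cV[R]_m => v j 0)
    p cvg_fst (@coord_continuous R m 1 j 0 _)).
have csnd j : continuous (fun p : 'cV[R]_m * 'cV[R]_q => p.2 j 0).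
  by move=> p; exact: (@continuous_comp _ _ _ snd (fun v : 'cV[R]_q => v j 0)
    p cvg_snd (@coord_continuous R q 1 j 0 _)).
under eq_fun do rewrite enorm_sqr.
apply: continuous_sumr => i.
suff ci : continuous (fun p => estimation_error p i 0) by exact: continuous_mulr.
have coordE (u : 'cV[R]_nu) (G : 'M[R]_(nu, q)) (N : 'M[R]_(nu, m)) e f :
    (- u + G *m e + N *m f) i 0 =
    - u i 0 + \sum_a G i a * e a 0 + \sum_j N i j * f j 0.
  by rewrite !mxE.
under eq_fun do rewrite estimation_errorE coordE.
apply: continuous_addr; [apply: continuous_addr|].
- exact: cst_continuous.
- by apply: continuous_sumr => j; apply: continuous_mulr => //; exact: cst_continuous.
- by apply: continuous_sumr => j; apply: continuous_mulr => //; exact: cst_continuous.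
Qed.

End EstimationError.

Lemma ltr_enorm_sqr (R : realType) n (r : R) (u : 'cV[R]_n) : 0 <= r ->
  (3 * r < enorm u) = (9 * r ^+ 2 < enorm u ^+ 2).
Proof.
move=> r0; rewrite -[9]/((3 * 3)%:R) natrM -expr2 -exprMn.
by rewrite ltr_pXn2r// nnegrE ?enorm_ge0// mulr_ge0.
Qed.

Section ErrorBound.
Context (R : realType) (n m nu q J : nat).
Variables (TT : set 'cV[R]_J) (Tm : 'I_J -> 'M[R]_n).
Hypothesis hT : ellitope_data TT Tm.
Variables (B : 'M[R]_(nu, n)) (A : 'M[R]_(m, n)) (Aa : 'I_q -> 'M[R]_(m, n)).
Variables (sigma : R) (Rl : 'M[R]_nu) (H : 'M[R]_(m, nu)).
Hypotheses (nu_gt0 : (0 < nu)%N) (q_gt0 : (0 < q)%N).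
Hypotheses (sigma_ge0 : 0 <= sigma) (Rlpsd : psdmx Rl).
Context (d : measure_display) (Om : measurableType d) (P : probability Om R).
Variables (xi : Om -> 'cV[R]_m) (eta : Om -> 'cV[R]_q).
Hypothesis hmeas :
  random_element (fun w => (xi w, eta w) : 'cV[R]_m * 'cV[R]_q).
Hypotheses (hxi2 : has_second_moment P xi) (heta2 : has_second_moment P eta).
Hypothesis hxi : loewner_le (second_moment P xi) (sigma ^+ 2 *: 1%:M).
Hypothesis heta : loewner_le (second_moment P eta) 1%:M.
Variable x : 'cV[R]_n.
Hypothesis xX : ellitope TT Tm x.

Let S := sqrtmx Rl.
Let err (w : Om) := estimation_error B A Aa S H x (xi w, eta w).

Lemma measurable_error : measurable_fun [set: Om] (fun w => enorm (err w) ^+ 2).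
Proof.
exact: (measurable_continuous_comp hmeas
  (@continuous_estimation_error _ _ _ _ _ B A Aa S H x)).
Qed.

Lemma error_second_moment :
  (\int[P]_w (enorm (err w) ^+ 2)%:E <=
   (Rtilde TT Tm B A Aa sigma Rl H ^+ 2)%:E)%E.
Proof.
have [[Ss _] _] := sqrtmxP Rlpsd.
pose E := (\int[P]_w (enorm (err w) ^+ 2)%:E)%E.
have E0 : (0 <= E)%E by apply: integral_ge0 => w _; rewrite lee_fin sqr_ge0.
have bound lam kap mu vkap e : risk_feasible Tm B A Aa Rl H lam kap mu vkap ->
    0 < e -> (E <= ((sigma * fro_norm (H *m S) + lam + support_fun TT mu
          + kap + support_fun TT vkap + e) ^+ 2)%:E)%E.
  move=> F e0; have [l0 k0 m0 v0] := risk_feasible_ge0 hT nu_gt0 q_gt0 F.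
  (* The weights [a], [b], [c] bound the bias, perturbation and noise contributions; [e3] keeps them
     positive. Each second moment is at most the square of its weight, so the weighted sum is at
     most [a + b + c]. *)
  pose e3 := e / 3; have e30 : 0 < e3 by rewrite divr_gt0.
  pose a := kap + support_fun TT vkap + e3.
  pose b := lam + support_fun TT mu + e3.
  pose c := sigma * fro_norm (H *m S) + e3.
  have s0 : 0 <= sigma * fro_norm (H *m S) by rewrite mulr_ge0// sqrtr_ge0.
  have a0 : 0 < a by rewrite /a; lra.
  have b0 : 0 < b by rewrite /b; lra.
  have c0 : 0 < c by rewrite /c; lra.
  pose G := \matrix_(i, j) (S *m H^T *m Aa j *m x) i 0.
  pose va := S *m (B - H^T *m A) *m x.
  have ava : enorm va ^+ 2 <= a ^+ 2.
    rewrite ler_pXn2r// ?nnegrE ?enorm_ge0// ?ltW//.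
    by have := risk_feasible_bias hT nu_gt0 F xX; rewrite /a -/S -/va; lra.
  have [etaM [etaI etaB]] : exists r, has_mean P (fun w => enorm (G *m eta w) ^+ 2) r
      /\ r <= b ^+ 2.
    eexists; split; first exact: (second_moment_quadratic G heta2).
    apply: le_trans (loewner_row_bound G (_ : loewner_le _ (1 *: 1%:M))) _.
      by rewrite scale1r.
    rewrite mul1r ler_pXn2r// ?nnegrE ?sqrtr_ge0// ?ltW//.
    have := risk_feasible_perturbation hT nu_gt0 q_gt0 F xX.
    by rewrite /b -/S -/G; lra.
  have [xiM [xiI xiB]] : exists r,
      has_mean P (fun w => enorm (S *m H^T *m xi w) ^+ 2) r /\ r <= c ^+ 2.
    eexists; split; first exact: (second_moment_quadratic (S *m H^T) hxi2).
    apply: le_trans (loewner_row_bound (S *m H^T) hxi) _.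
    have -> : S *m H^T = (H *m S)^T by rewrite trmx_mul Ss.
    rewrite fro_norm_tr -exprMn ler_pXn2r// ?nnegrE// ?ltW//.
    by rewrite /c; lra.
  have gM : has_mean P (fun w => (a + b + c) * (a^-1 * enorm (- va) ^+ 2 +
      (b^-1 * enorm (G *m eta w) ^+ 2 + c^-1 * enorm (S *m H^T *m xi w) ^+ 2)))
      ((a + b + c) * (a^-1 * enorm (- va) ^+ 2 + (b^-1 * etaM + c^-1 * xiM))).
    apply: has_meanZ; apply: has_meanD; first exact: has_mean_cst.
    by apply: has_meanD; exact: has_meanZ.
  apply: (@le_trans _ _ (\int[P]_w ((a + b + c) * (a^-1 * enorm (- va) ^+ 2 +
      (b^-1 * enorm (G *m eta w) ^+ 2 +
       c^-1 * enorm (S *m H^T *m xi w) ^+ 2)))%:E)%E).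
    apply: ge0_le_integral => //.
    - by move=> w _; rewrite lee_fin sqr_ge0.
    - exact/measurable_EFinP/measurable_error.
    - exact: measurable_int gM.1.
    - move=> w _; rewrite lee_fin /err estimation_errorE.
      exact: enorm_sqrD3_weighted.
  rewrite gM.2 lee_fin.
  have -> : sigma * fro_norm (H *m S) + lam + support_fun TT mu + kap
      + support_fun TT vkap + e = a + b + c by rewrite /a /b /c /e3; field.
  rewrite [leRHS]expr2 ler_wpM2l//; first by rewrite !addr_ge0// ltW.
  rewrite -addrA enormN lerD ?lerD// mulrC ler_pdivrMr// -expr2//.
have Efin : E \is a fin_num.
  have [lam [kap [mu [vkap F]]]] := risk_feasible_exists hT B A Aa H Rlpsd.
  by rewrite ge0_fin_numE// (le_lt_trans (bound _ _ _ _ _ F ltr01))// ltry.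
rewrite -/E -(fineK Efin) lee_fin.
have R0 := Rtilde_ge0 hT B A Aa H nu_gt0 q_gt0 sigma_ge0 Rlpsd.
have f0 : 0 <= fine E by rewrite fine_ge0.
(* The square root of the second moment is a lower bound of the objective once [e] tends to 0, hence
   a lower bound of its infimum. *)
rewrite -[leLHS]sqr_sqrtr// ler_pXn2r// ?nnegrE ?sqrtr_ge0//.
apply: le_Rtilde => // lam kap mu vkap F; apply/ler_addgt0Pr => e e0.
have := bound _ _ _ _ _ F e0; rewrite -(fineK Efin) lee_fin => h.
have [l0 k0 m0 v0] := risk_feasible_ge0 hT nu_gt0 q_gt0 F.
have s0 : 0 <= sigma * fro_norm (H *m S) by rewrite mulr_ge0// sqrtr_ge0.
rewrite -(@ler_pXn2r _ 2)// ?nnegrE ?sqrtr_ge0//; last first.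
  by rewrite -/S; lra.
by rewrite sqr_sqrtr.
Qed.

Lemma error_tail :
  (P [set w | (3 * Rtilde TT Tm B A Aa sigma Rl H < enorm (err w))%R]
   <= (9^-1)%:E)%E.
Proof.
set r := Rtilde _ _ _ _ _ _ _ _.
have r0 : 0 <= r := Rtilde_ge0 hT B A Aa H nu_gt0 q_gt0 sigma_ge0 Rlpsd.
under eq_set do rewrite ltr_enorm_sqr//.
apply: markov_square => //; [exact: measurable_error| |exact: error_second_moment].
by move=> w; rewrite sqr_ge0.
Qed.

End ErrorBound.

(** * Tails of the geometric medians and risk of the aggregated estimate *)

Theorem proposition2p2 (R : realType) (n m nu q J L K : nat)
    (nu_gt0 : (0 < nu)%N) (q_gt0 : (0 < q)%N)
    (* signal set *)
    (TT : set 'cV[R]_J) (Tm : 'I_J -> 'M[R]_n) (hT : ellitope_data TT Tm)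
    (* error norm *)
    (Rm : 'I_L -> 'M[R]_nu) (hR : forall l, psdmx (Rm l))
    (hRsum : pdmx (\sum_l Rm l))
    (B : 'M[R]_(nu, n)) (A : 'M[R]_(m, n)) (Aa : 'I_q -> 'M[R]_(m, n))
    (sigma eps : R) (sigma_gt0 : 0 < sigma) (eps_gt0 : 0 < eps)
    (eps_lt1 : eps < 1)
    (* noises *)
    (d : measure_display) (Om : measurableType d) (P : probability Om R)
    (xi : 'I_K -> Om -> 'cV[R]_m) (eta : 'I_K -> Om -> 'cV[R]_q)
    (hmeas : forall k,
      random_element (fun w => (xi k w, eta k w) : 'cV[R]_m * 'cV[R]_q))
    (hind : mutually_independent P
      (fun k w => (xi k w, eta k w) : 'cV[R]_m * 'cV[R]_q))
    (hxi2 : forall k, has_second_moment P (xi k))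
    (hxi : forall k,
      loewner_le (second_moment P (xi k)) (sigma ^+ 2 *: 1%:M))
    (heta2 : forall k, has_second_moment P (eta k))
    (heta : forall k, loewner_le (second_moment P (eta k)) 1%:M)
    (* estimates *)
    (H : 'I_L -> 'M[R]_(m, nu))
    (z : 'I_L -> ('I_K -> 'cV[R]_m) -> 'cV[R]_nu)
    (hz : forall l (om : 'I_K -> 'cV[R]_m),
      geometric_median (Rm l) (fun k => (H l)^T *m om k) (z l om))
    (what : ('I_K -> 'cV[R]_m) -> 'cV[R]_nu) (w0 : 'cV[R]_nu) :
  let XX := ellitope TT Tm in
  let Rt (l : 'I_L) : R := Rtilde TT Tm B A Aa sigma (Rm l) (H l) in
  let obs (x : 'cV[R]_n) (w : Om) (k : 'I_K) : 'cV[R]_m :=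
    perturbed A Aa (eta k w) *m x + xi k w in
  let WW (om : 'I_K -> 'cV[R]_m) : set 'cV[R]_nu :=
    \bigcap_l [set v | enorm (sqrtmx (Rm l) *m (z l om - v)) <= 4 * Rt l] in
  (forall om, WW om !=set0 -> WW om (what om)) ->
  (forall om, ~ (WW om !=set0) -> what om = w0) ->
  [/\ forall (l : 'I_L) (k : 'I_K),
        (ereal_sup
           [set 'E_P[fun w => (enorm (sqrtmx (Rm l) *m
                       ((H l)^T *m obs x w k - B *m x)) ^+ 2)%R] | x in XX]
         <= ((Rt l) ^+ 2)%:E)%E,
      (* for Rt l = 0 the event below is the sure event, whence 0 < Rt l here
         and the strict inequality, for every Rt l, in the next item *)
      forall (l : 'I_L) (x : 'cV[R]_n), XX x -> 0 < Rt l ->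
        (Prob P [set w | (4 * Rt l <=
                   enorm (sqrtmx (Rm l) *m (z l (obs x w) - B *m x)))%R]
         <= (expR (- (107 / 1000) * K%:R))%:E)%E,
      forall (l : 'I_L) (x : 'cV[R]_n), XX x ->
        (Prob P [set w | (4 * Rt l <
                   enorm (sqrtmx (Rm l) *m (z l (obs x w) - B *m x)))%R]
         <= (expR (- (107 / 1000) * K%:R))%:E)%E
    & ln (L%:R / eps) / (107 / 1000) <= K%:R ->
        (eps_risk P Rm B XX eps (fun x w => what (obs x w))
         <= (8 * \big[Num.max/0]_(l < L) Rt l)%:E)%E].
Proof.
move=> XX Rt obs WW whatW what0.
have Rt0 l : 0 <= Rt l.
  exact: (Rtilde_ge0 hT B A Aa (H l) nu_gt0 q_gt0 (ltW sigma_gt0) (hR l)).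
(* One measurable event serves both tail claims: [0 < D] follows from [0 < Rt l] in the first and
   from strictness in the second. *)
have outliers l x : XX x -> exists2 E : set Om, measurable E &
    (forall w (D := enorm (sqrtmx (Rm l) *m (z l (obs x w) - B *m x))),
       0 < D -> 4 * Rt l <= D -> E w) /\
    (P E <= (expR (- (107 / 1000) * K%:R))%:E)%E.
  move=> xX.
  pose err := estimation_error B A Aa (sqrtmx (Rm l)) (H l) x.
  have bad_borel (k : 'I_K) : borel [set p | 3 * Rt l < enorm (err p)].
    apply: sub_sigma_algebra; under eq_set do rewrite ltr_enorm_sqr//.
    have /continuousP := @continuous_estimation_error _ _ _ _ _ B A Aa
      (sqrtmx (Rm l)) (H l) x.
    move=> /(_ `]9 * Rt l ^+ 2, +oo[%classic) errC.
    rewrite (_ : mkset _ = (fun p => enorm (err p) ^+ 2) @^-1`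
      `]9 * Rt l ^+ 2, +oo[%classic); first by apply: errC; exact: interval_open.
    by apply/seteqP; split => p; rewrite /= in_itv/= andbT.
  have bad_prob k := error_tail hT B A Aa (H l) nu_gt0 q_gt0 (ltW sigma_gt0)
    (hR l) (hmeas k) (hxi2 k) (heta2 k) (hxi k) (heta k) xX.
  have [E mE [Emany PE]] := third_successes_bound hmeas hind bad_borel bad_prob.
  exists E => //; split=> // w D D0 RD; apply: Emany.
  apply: leq_trans (geometric_median_outliers (hz l (obs x w)) D0) _.
  rewrite leq_mul2l/= subset_leq_card//; apply/fintype.subsetP => k.
  rewrite !inE => kD.
  (* The outlier threshold depends on the median, hence on all observations; lowering it to the
     deterministic [3 * Rt l] makes each bad event depend on one noise pair. *)
  have RD' : 3 * Rt l <= 3 / 4 * D by move: (Rt l) D RD {D0 kD} => r D RD; lra.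
  by apply/asboolP/asboolP; exact: (le_lt_trans RD' kD).
split.
- move=> l k; apply: ge_ereal_sup => _ [x xX <-]; rewrite unlock.
  exact: (error_second_moment hT B A Aa (H l) nu_gt0 q_gt0 (ltW sigma_gt0) (hR l)
    (hmeas k) (hxi2 k) (heta2 k) (hxi k) (heta k) xX).
- move=> l x xX Rl0; have [E mE [sub PE]] := outliers l x xX.
  apply: le_trans PE; rewrite -Prob_measurable//; apply: le_mu_ext => w /= h.
  by apply: sub => //; rewrite (lt_le_trans _ h)// mulr_gt0.
- move=> l x xX; have [E mE [sub PE]] := outliers l x xX.
  apply: le_trans PE; rewrite -Prob_measurable//; apply: le_mu_ext => w /= h.
  by apply: sub; [rewrite (le_lt_trans _ h)// mulr_ge0|exact: ltW].
move=> Kge; apply: ge_ereal_sup => _ [x xX <-].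
apply: ereal_inf_lbound; set M := \big[_/_]_(_ < _) _.
exists (8 * M) => //=.
pose E l := projT1 (cid2 (outliers l x xX)).
have mE l : measurable (E l) by rewrite /E; case: cid2.
have subE l w (D := enorm (sqrtmx (Rm l) *m (z l (obs x w) - B *m x))) :
    0 < D -> 4 * Rt l <= D -> E l w.
  by rewrite /D /E; case: cid2 => /= F _ [h _]; exact: h.
have PE l : (P (E l) <= (expR (- (107 / 1000) * K%:R))%:E)%E.
  by rewrite /E; case: cid2 => /= F _ [].
apply: (@le_trans _ _ (P (\big[setU/set0]_l E l))).
  rewrite -Prob_measurable; last exact: bigsetU_measurable.
  apply: le_mu_ext => w /= hM; apply: contrapT => wE.
  (* Off the exceptional events [B *m x] itself lies in [WW], so this set is nonempty and contains
     the estimate. Both points are within [4 * Rt l] of the median, whence the factor 8. *)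
  have close l : enorm (sqrtmx (Rm l) *m (z l (obs x w) - B *m x)) <= 4 * Rt l.
    rewrite leNgt; apply/negP => h; apply: wE.
    rewrite (bigD1 l)//=; left; apply: subE; last exact: ltW.
    by rewrite (le_lt_trans _ h)// mulr_ge0.
  have xW : WW (obs x w) (B *m x) by move=> l _; exact: close.
  have wW := whatW _ (ex_intro _ _ xW).
  move: hM; rewrite ltNge => /negP; apply.
  have M0 : 0 <= 8 * M by rewrite mulr_ge0//; apply: bigmax_ge_id.
  apply: bigmax_le => // l _; rewrite sqrt_form_sqrtmx//.
  have -> : B *m x - what (obs x w) =
      (z l (obs x w) - what (obs x w)) - (z l (obs x w) - B *m x).
    by rewrite opprB [RHS]addrC addrA subrK.
  rewrite mulmxBr (le_trans (ler_enormD _ _))// enormN.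
  have RM : Rt l <= M by exact: le_bigmax.
  by have := close l; have := wW l I; rewrite /=; lra.
apply: (le_trans (@le_measure_bigsetU _ _ _ P _ xpredT E mE)).
apply: (le_trans (lee_sum _ (fun l _ => PE l))).
rewrite sumEFin lee_fin sumr_const card_ord -[leLHS]mulr_natl.
have [->|L0] := posnP L; first by rewrite mul0r ltW.
(* Taking logarithms turns the union bound, [L] times the tail at most [eps], into the assumption on
   [K]. *)
rewrite mulNr expRN ler_pdivrMr ?expR_gt0// mulrC -ler_pdivrMr//.
have Leps : 0 < L%:R / eps by rewrite divr_gt0// ltr0n.
have <- : expR (ln (L%:R / eps)) = L%:R / eps by apply: lnK; rewrite posrE.
rewrite ler_expR.
have c0 : 0 < 107 / 1000 :> R by lra.
move: c0 Kge; move: (107 / 1000) => c c0.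
by rewrite ler_pdivrMr// [c * _]mulrC.
Qed.
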